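(* Let $r>0$, and let $\psi:\mathbb{R}\to\mathbb{R}_+$ be a convex function attaining its minimal value $0$ at zero. Suppose that $$\lim_{b\to\infty}m_{\psi}(b)<\infty,\qquad\text{where } m_{\psi}(b):=\int_1^b a\,\psi(a^{-1})\,\mathrm{d}a,\quad b\ge1.$$ Then, almost surely, $I_W^{\psi}(T,r)$ is uniformly bounded in $T>0$ and increases monotonically (in $T$) to its finite limit as $T\to\infty$.
   Context: $W(\cdot)$ is a standard Wiener process on $[0,\infty)$ with $W(0)=0$. $AC[0,T]$ is the space of absolutely continuous functions on $[0,T]$. $\mathbb{R}_+=[0,\infty)$. For convex $\psi:\mathbb{R}\to\mathbb{R}_+$ and $h\in AC[0,T]$, $|h|_T^{\psi}:=\int_0^T\psi(h'(t))\,\mathrm{d}t$. For $T,r>0$, $I_W^{\psi}(T,r):=\inf\{|h|_T^{\psi}: h\in AC[0,T],\ h(0)=r,\ h(t)\ge W(t)\ \text{for all } t\in[0,T]\}$ (a random variable; equivalently one may require $h(0)=0$ and $h\ge W-r$). ''Increases'' is meant in the non-strict sense. *)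

(* Defs.v *)
From HB Require Import structures.
From mathcomp Require Import all_boot all_order all_algebra.
From mathcomp Require Import all_classical all_reals all_analysis.
Import Order.TTheory GRing.Theory Num.Theory.
Import numFieldNormedType.Exports.

Set Implicit Arguments.
Unset Strict Implicit.
Unset Printing Implicit Defensive.

Local Open Scope classical_set_scope.
Local Open Scope ring_scope.

(* Sub-families are covered by taking [B i := setT]. *)
Definition mutually_independent d (Omega : measurableType d) (R : realType)
    (P : probability Omega R) (n : nat) (X : 'I_n -> Omega -> R) : Prop :=
  forall B : 'I_n -> set R, (forall i, measurable (B i)) ->
    P (\bigcap_(i in [set: 'I_n]) (X i @^-1` B i)) =
    (\prod_(i < n) P (X i @^-1` B i))%E.

(* Times are real numbers, but only [W t] with [0 <= t] is constrained (or used
   below).  The second parameter of [normal_prob] is the standard deviation. *)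
Record wiener_process d (Omega : measurableType d) (R : realType)
    (P : probability Omega R) (W : R -> {RV P >-> R}) : Prop := {
  wiener_start : \forall w \ae P, W 0 w = 0 ;
  wiener_independent_increments : forall (n : nat) (t : nat -> R),
    0 <= t 0%N -> (forall i, (i < n)%N -> t i <= t i.+1) ->
    mutually_independent P
      (fun i : 'I_n => W (t i.+1) \- W (t i)) ;
  wiener_gaussian_increments : forall s t : R, 0 <= s -> s < t ->
    forall B : set R, measurable B ->
      pushforward P (W t \- W s) B =
      normal_prob 0 (Num.sqrt (t - s)) B ;
  wiener_continuous :
    \forall w \ae P, {within `[0, +oo[, continuous (fun t : R => W t w)} }.

Arguments wiener_process {d Omega R} P W.

Definition absolutely_continuous (R : realType) (a b : R) (h : R -> R) : Prop :=
  forall e : R, 0 < e -> exists2 delta : R, 0 < delta &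
    forall (n : nat) (x y : 'I_n -> R),
      (forall i, [/\ a <= x i, x i <= y i & y i <= b]) ->
      trivIset [set: 'I_n] (fun i => `]x i, y i[%classic) ->
      \sum_(i < n) (y i - x i) < delta ->
      \sum_(i < n) `|h (y i) - h (x i)| < e.

(* $|h|_T^\psi$.  [h^`()] is total, with a dummy value where [h] is not
   differentiable; for [h] in $AC[0,T]$ this concerns only a null set of
   [`[0, T]]. *)
Definition action (R : realType) (psi : R -> R) (T : R) (h : R -> R) : \bar R :=
  (\int[lebesgue_measure]_(t in `[0%R, T]) (psi ((h^`()%classic) t))%:E)%E.

(* $I_f^\psi(T,r)$ for an obstacle [f]; the infimum of the empty set is [+oo]. *)
Definition min_action (R : realType) (psi : R -> R) (f : R -> R) (T r : R) :
    \bar R :=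
  ereal_inf [set action psi T h | h in
    [set h : R -> R | [/\ absolutely_continuous 0 T h, h 0 = r &
                          forall t, 0 <= t <= T -> f t <= h t]]].

(* $m_\psi(b)$ *)
Definition m_psi (R : realType) (psi : R -> R) (b : R) : \bar R :=
  (\int[lebesgue_measure]_(a in `[1%R, b]) (a * psi a^-1)%:E)%E.

(* Main.v *)
(* On [[0, 4^k]], a base-4 chaining argument bounds [W] by [16 * 2^(k+j)] outside
   an event of probability [O(16^-j)]; it only uses that the increments have
   Gaussian fourth-power tails and that paths are continuous.  Let [J l] be the least
   [j] for which the bound holds at scale [k = l + 8].  A nondecreasing function,
   affine between the knots [4^k] and climbing to the current bound of [W] at each
   knot, has slope at most [2^(J l - l)] at scale [l], so its cost is a constant
   times the sum of [4^l * psi (2^(J l - l)) = 4^(J l) * a_(l - J l)], where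
   [a_m = 4^m * psi (2^-m)].  By comparison of the integral defining [m_psi] with a
   dyadic sum, [a] is summable; the expected cost is then at most the sum of
   [4^j * a_(l - j) * O(16^-j)] over [j <= l], a Cauchy product of convergent series.
   Borel-Cantelli gives [J l <= l] for large [l], and the finitely many remaining
   scales are handled by one affine piece, available because [W 0 = 0 < r].
   Monotonicity in [T] is restriction of admissible functions. *)
Require Import Defs.
From HB Require Import structures.
From mathcomp Require Import all_boot all_order all_algebra.
From mathcomp Require Import all_classical all_reals all_analysis.
From mathcomp Require Import measurable_realfun zify ring lra.
Import Order.TTheory GRing.Theory Num.Theory.
Import numFieldNormedType.Exports.
Local Open Scope classical_set_scope.
Local Open Scope ring_scope.

Set Implicit Arguments.
Unset Strict Implicit.
Unset Printing Implicit Defensive.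

(** * Monotonicity of [psi], of the action and of the minimal action *)

(** Writing [x] as the convex combination of [y] and [0] with weight [x / y] gives
    [psi x <= (x / y) * psi y], as [psi 0 = 0]. *)
Lemma convex_ge0_nondecreasing (R : realType) (psi : R -> R)
    (psi_ge0 : forall x, 0 <= psi x)
    (psi_convex : convex_function [set: convex_lmodType R^o] psi)
    (psi0 : psi 0 = 0) (x y : R) :
  0 <= x -> x <= y -> psi x <= psi y.
Proof.
move=> x0; rewrite le_eqVlt => /predU1P[->//|xy].
have y0 : 0 < y by exact: le_lt_trans xy.
have t0 : 0 <= x / y by rewrite divr_ge0// ltW.
have t1 : x / y <= 1 by rewrite ler_pdivrMr// mul1r ltW.
have /= := psi_convex (Itv01 t0 t1) y 0.
rewrite !inE => /(_ Logic.I Logic.I).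
have -> : psi (conv (Itv01 t0 t1) (y : convex_lmodType R^o) 0) = psi x.
  congr psi; transitivity ((x / y) * y + (1 - x / y) * 0) => //.
  by rewrite mulr0 addr0 mulfVK ?gt_eqF.
rewrite convRE psi0 mulr0 addr0 => /le_trans; apply.
by rewrite ler_piMl.
Qed.

(** Read off from the integral as a supremum over simple functions, so that it applies directly to
    [psi] of the derivative of an arbitrary admissible [h]. *)
Lemma le_integral_ge0 d (T : measurableType d) (R : realType)
    (mu : {measure set T -> \bar R}) (D : set T) (f g : T -> \bar R) :
  (forall x, D x -> 0 <= f x)%E -> (forall x, D x -> f x <= g x)%E ->
  (\int[mu]_(x in D) f x <= \int[mu]_(x in D) g x)%E.
Proof.
move=> f0 fg; rewrite (integral_mkcond D f) (integral_mkcond D g).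
have g0 x : D x -> (0 <= g x)%E by move=> Dx; exact: le_trans (f0 _ Dx) (fg _ Dx).
rewrite !ge0_integralTE; [|by move=> x; exact: erestrict_ge0..].
apply: ereal_sup_le => _ /= [h hf <-]; exists h => // x.
by apply: le_trans (hf x) _; exact: lee_restrict.
Qed.

Lemma action_ge0 (R : realType) (psi : R -> R)
    (psi_ge0 : forall x, 0 <= psi x) (T : R) (h : R -> R) :
  (0 <= action psi T h)%E.
Proof. by apply: integral_ge0 => x _; rewrite lee_fin. Qed.

Lemma le_action (R : realType) (psi : R -> R)
    (psi_ge0 : forall x, 0 <= psi x) (S T : R) (h : R -> R) :
  S <= T -> (action psi S h <= action psi T h)%E.
Proof.
move=> ST; rewrite /action integral_mkcond [leRHS]integral_mkcond.
apply: le_integral_ge0 => x _; first by apply: erestrict_ge0 => y _; rewrite lee_fin.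
rewrite /patch; case: ifPn => xS; last by case: ifP => //; rewrite lee_fin.
rewrite ifT// inE/= in_itv/=; move: xS; rewrite inE/= in_itv/= => /andP[-> xS].
exact: le_trans ST.
Qed.

Lemma absolutely_continuous_subset (R : realType) (a b c : R) (h : R -> R) :
  b <= c -> absolutely_continuous a c h -> absolutely_continuous a b h.
Proof.
move=> bc H e /H[dl dl0 {}H]; exists dl => // n x y xy; apply: H => i.
by have [-> -> /le_trans->] := xy i.
Qed.

Lemma min_action_ge0 (R : realType) (psi : R -> R)
    (psi_ge0 : forall x, 0 <= psi x) (f : R -> R) (T r : R) :
  (0 <= min_action psi f T r)%E.
Proof. by apply: le_ereal_inf_tmp => _ [h _ <-]; exact: action_ge0. Qed.

Lemma le_min_action (R : realType) (psi : R -> R)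
    (psi_ge0 : forall x, 0 <= psi x) (f : R -> R) (S T r : R) :
  S <= T -> (min_action psi f S r <= min_action psi f T r)%E.
Proof.
move=> ST; apply: le_ereal_inf_tmp => _ [h [hac h0 hf] <-].
apply: le_trans (le_action psi_ge0 h ST).
apply: ereal_inf_lbound; exists h => //; split => //.
  exact: absolutely_continuous_subset hac.
by move=> t /andP[t0 tS]; rewrite hf// t0 (le_trans tS).
Qed.

Lemma lipschitz_absolutely_continuous (R : realType) (a b L : R) (h : R -> R) :
  (forall x y, x <= y -> `|h y - h x| <= L * (y - x)) ->
  absolutely_continuous a b h.
Proof.
move=> hL e e0; exists (e / (`|L| + 1)); first by rewrite divr_gt0// ltr_wpDl.
move=> n x y xy _ sxy.
have L1 : 0 < `|L| + 1 by rewrite ltr_wpDl.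
have s0 : 0 <= \sum_(i < n) (y i - x i).
  by apply: sumr_ge0 => i _; rewrite subr_ge0; case: (xy i).
apply: (@le_lt_trans _ _ ((`|L| + 1) * \sum_(i < n) (y i - x i))).
  rewrite mulr_sumr; apply: ler_sum => i _; have [_ xyi _] := xy i.
  apply: le_trans (hL _ _ xyi) _; apply: ler_wpM2r; first by rewrite subr_ge0.
  by rewrite (le_trans (ler_norm L))// lerDl.
by rewrite mulrC -ltr_pdivlMr.
Qed.

Lemma min_action_bounded_cvg (R : realType) (psi : R -> R)
    (psi_ge0 : forall x, 0 <= psi x) (f : R -> R) (r M : R) :
  (forall T, 0 < T -> (min_action psi f T r <= M%:E)%E) ->
  exists l : R, min_action psi f T r @[T --> +oo%R] --> l%:E.
Proof.
move=> fM; set I := fun T => min_action psi f T r.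
have /nondecreasing_cvge : nondecreasing_fun I.
  by move=> S T; exact: le_min_action.
set s := ereal_sup _ => Is.
have s0 : (0 <= s)%E.
  apply: le_trans (min_action_ge0 psi_ge0 f 0 r) _.
  by apply: ereal_sup_ubound; exists 0.
have sM : (s <= M%:E)%E.
  apply: ge_ereal_sup => _ [T _ <-].
  (* The supremum runs over all real [T], the bound only over positive ones; by monotonicity [T] may
     be raised to at least [1]. *)
  apply: (@le_trans _ _ (I (Order.max T 1))).
    by apply: le_min_action => //; rewrite le_max lexx.
  by apply: fM; rewrite lt_max ltr01 orbT.
exists (fine s); rewrite fineK// ge0_fin_numE//.
by rewrite (le_lt_trans sM)// ltry.
Qed.

(** * From the integral [m_psi] to a dyadic sum *)

(** On the interval from [2^n] to [2^(n+1)], of length [2^n], the integrand is at least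
    [2^n * psi (2^-(n+1))], so this block of [m_psi] dominates [4^n * psi (2^-(n+1))]. *)
Lemma dyadic_sum_bounded (R : realType) (psi : R -> R)
    (psi_ge0 : forall x, 0 <= psi x)
    (psi_nd : forall x y : R, 0 <= x -> x <= y -> psi x <= psi y)
    (m_psi_lim : (lim (m_psi psi b @[b --> +oo%R]) < +oo)%E) :
  exists M : R, forall n, \sum_(m < n) 4 ^+ m * psi (2 ^- m) <= M.
Proof.
(* Truncating at [1] leaves the integrand unchanged for [a >= 1] and makes its second factor
   monotone on the whole line, hence measurable. *)
pose f (a : R) : R := a * psi (Num.max a 1)^-1.
have mf : measurable_fun [set: R] f.
  apply: measurable_funM => //.
  apply: nonincreasing_measurable => // x y xy.
  apply: psi_nd; first by rewrite invr_ge0 le_max ler01 orbT.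
  rewrite lef_pV2 ?posrE ?lt_max ?ltr01 ?orbT//.
  by rewrite ge_max !le_max xy lexx orbT.
have f0 a : 1 <= a -> 0 <= f a by move=> a1; rewrite mulr_ge0// (le_trans ler01).
have mE b : m_psi psi b = (\int[lebesgue_measure]_(a in `[1%R, b]) (f a)%:E)%E.
  apply: eq_integral => a; rewrite inE/= in_itv/= => /andP[a1 _].
  by rewrite /f max_l.
have mnd : nondecreasing_fun (m_psi psi).
  move=> b c bc; rewrite !mE; apply: ge0_subset_integral => //.
  - exact/measurable_EFinP/measurable_funTS.
  - by move=> a; rewrite /= in_itv/= => /andP[a1 _]; rewrite lee_fin f0.
  - by apply: subset_itvl; rewrite bnd_simp.
have /nondecreasing_cvge/cvg_lim ml := mnd.
rewrite ml// in m_psi_lim; set s := ereal_sup _ in ml m_psi_lim.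
have step n : ((\sum_(m < n) 4 ^+ m * psi (2 ^- m.+1))%:E <= m_psi psi (2 ^+ n))%E.
  elim: n => [|n IH].
    rewrite big_ord0 mE; apply: integral_ge0 => a /=.
    by rewrite in_itv/= => /andP[a1 _]; rewrite lee_fin f0.
  have n1 : (1 : R) <= 2 ^+ n by rewrite exprn_ege1// ler1n.
  have nn : (2 : R) ^+ n <= 2 ^+ n.+1 by rewrite ler_weXn2l// ler1n.
  rewrite big_ord_recr/= EFinD mE.
  rewrite (@itv_bndbnd_setU _ _ _ (BRight (2 ^+ n))) ?bnd_simp//.
  rewrite ge0_integral_setU//=; last 3 first.
  - exact/measurable_EFinP/measurable_funTS.
  - move=> a; rewrite /= !in_itv/= => -[/andP[a1 _]|/andP[a1 _]];
      rewrite lee_fin f0//.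
    exact: le_trans n1 (ltW a1).
  - rewrite disj_set2E; apply/eqP; rewrite -subset0 => a /=.
    by rewrite !in_itv/= => -[/andP[_ a1] /andP[a2 _]]; move: a1; rewrite leNgt a2.
  rewrite -mE; apply: leeD => //.

  pose c : R := 2 ^+ n * psi (2 ^- n.+1).
  apply: (@le_trans _ _ (\int[lebesgue_measure]_(a in `](2 ^+ n)%R, (2 ^+ n.+1)%R]) c%:E)%E).
    rewrite integral_cst//= lebesgue_measure_itv/= lte_fin ltr_eXn2l ?ltr1n//.
    rewrite ltnSn -EFinB -EFinM lee_fin /c.
    rewrite le_eqVlt; apply/orP; left; apply/eqP.
    have -> : (4 : R) = 2 * 2 by ring.
    by rewrite exprMn exprS; ring.
  apply: le_integral_ge0 => a /=; rewrite in_itv/= => /andP[a1 a2].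
    by rewrite lee_fin mulr_ge0// exprn_ge0.
  have a0 : 1 <= a by rewrite (le_trans n1)// ltW.
  rewrite lee_fin /c /f max_l//; apply: ler_pM => //; first exact: ltW.
  apply: psi_nd; first by rewrite invr_ge0 exprn_ge0.
  by rewrite lef_pV2// posrE ?exprn_gt0// (lt_le_trans ltr01).
have stepM n : \sum_(m < n) 4 ^+ m * psi (2 ^- m.+1) <= fine s.
  rewrite -lee_fin fineK; last first.
    rewrite ge0_fin_numE//; apply: (@le_trans _ _ (m_psi psi (2 ^+ 0))).
      by apply: le_trans (step 0); rewrite big_ord0.
    by apply: ereal_sup_ubound; exists (2 ^+ 0).
  by rewrite (le_trans (step n))//; apply: ereal_sup_ubound; exists (2 ^+ n).
(* The blocks control the terms from [m = 1] on, with a factor [4] from the index shift; [psi 1] is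
   the term [m = 0]. *)
exists (psi 1 + 4 * fine s) => -[|n].
  rewrite big_ord0 addr_ge0// mulr_ge0//.
  by have := stepM 0; rewrite big_ord0.
rewrite big_ord_recl/= expr0 mul1r invr1 lerD2l.
apply: le_trans (ler_wpM2l _ (stepM n)) => //.
rewrite mulr_sumr le_eqVlt; apply/orP; left; apply/eqP/eq_bigr => i _.
by rewrite /bump/= add1n exprS mulrA.
Qed.

(** * Piecewise affine majorants and their cost *)

(* The bound [b] on the endpoint is what lets the majorant be continued past [t]. *)
Definition majorant_with_cost (R : realType) (psi f : R -> R) (r t b S : R) :=
  exists h : R -> R, exists L : R,
    [/\ 0 <= L, forall x y : R, x <= y -> `|h y - h x| <= L * (y - x),
        h 0 = r, forall s : R, 0 <= s <= t -> f s <= h s & b <= h t] /\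
    [/\ measurable_fun (`]0, t[ : set R) (fun s => psi ((h^`()%classic) s)) &
        (\int[lebesgue_measure]_(s in `]0%R, t[) (psi ((h^`()%classic) s))%:E
           <= S%:E)%E].

Lemma min_action_le_cost (R : realType) (psi f : R -> R) (r t b S : R) :
  majorant_with_cost psi f r t b S -> (min_action psi f t r <= S%:E)%E.
Proof.
move=> [h [L [[L0 hL h0 hf hb] [mh hS]]]].
apply: le_trans hS; apply: (@le_trans _ _ (action psi t h)).
  apply: ereal_inf_lbound; exists h => //; split => //.
  exact: lipschitz_absolutely_continuous hL.
rewrite /action integral_itv_bndoo//.
exact/measurable_EFinP.
Qed.

Lemma derive1_affine (R : realType) (c A t : R) :
  (fun s : R => c + A * (s - t))^`()%classic = cst A.
Proof.
apply/funext => s; rewrite derive1E.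
have -> : (fun s : R => c + A * (s - t)) = cst c + cst A * (id - cst t).
  by apply/funext => u.
by rewrite derive_val add0r scaler0 addr0 subr0; exact: mulr1.
Qed.

Lemma near_eq_derive1 (R : realType) (g h : R -> R) (s : R) :
  (\near s, g s = h s) -> (g^`()%classic) s = (h^`()%classic) s.
Proof. by move=> gh; rewrite !derive1E; exact: near_eq_derive. Qed.

Lemma affine_majorant (R : realType) (psi f : R -> R)
    (psi_ge0 : forall x, 0 <= psi x) (r t dl F b : R) :
  0 < t -> 0 < dl -> (forall s : R, 0 <= s <= dl -> f s <= r) ->
  (forall s : R, 0 <= s <= t -> f s <= F) -> 0 <= r ->
  exists S, majorant_with_cost psi f r t b S.
Proof.
move=> t0 dl0 fr fF r0.
pose M := Num.max (Num.max F b) 0.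
have M0 : 0 <= M by rewrite le_max lexx orbT.
have FM : F <= M by rewrite !le_max lexx.
have bM : b <= M by rewrite !le_max lexx orbT.
(* The summand [M / dl] lifts the line above [F] from [dl] on, and [M / t] lifts it above [b] at
   [t]; before [dl] the starting height [r] suffices. *)
pose A := M / dl + M / t.
have A0 : 0 <= A by rewrite addr_ge0// divr_ge0// ltW.
have hd := derive1_affine r A 0.
exists (psi A * t), (fun s => r + A * (s - 0)), A; split; [split => //|split].
- move=> x y xy; have -> : r + A * (y - 0) - (r + A * (x - 0)) = A * (y - x) by ring.
  by rewrite ger0_norm// mulr_ge0// subr_ge0.
- by rewrite subrr mulr0 addr0.
- move=> s /andP[s0 st]; rewrite subr0; have [sdl|dls] := leP s dl.
    by rewrite (le_trans (fr s _)) ?s0// lerDl mulr_ge0.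
  rewrite (le_trans (fF s _)) ?s0// (le_trans FM)// ler_wpDl//.
  rewrite mulrDl ler_wpDr ?mulr_ge0 ?invr_ge0// ?(ltW t0)//.
  by rewrite mulrAC ler_pdivlMr// ler_wpM2l// ltW.
- rewrite subr0 (le_trans bM)// ler_wpDl// mulrDl mulfVK ?gt_eqF//.
  by rewrite lerDr mulr_ge0 ?(ltW t0)// divr_ge0// ltW.
- by rewrite hd; apply: (@measurable_cst _ _ _ _ _ (psi A)).
- rewrite hd (eq_integral (cst (psi A)%:E)); last by [].
  rewrite integral_cst//= lebesgue_measure_itv/= lte_fin t0 oppr0 adde0.
  by rewrite -EFinM.
Qed.

(** The new affine piece never descends from [h t >= b], so it stays above [f] up to [t']. Its cost
    is charged at slope [b' / (t' - t)], which does not depend on [h t] and dominates the true slope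
    because [h t >= 0]. *)
Lemma extend_majorant (R : realType) (psi f : R -> R)
    (psi_ge0 : forall x, 0 <= psi x)
    (psi_nd : forall x y : R, 0 <= x -> x <= y -> psi x <= psi y)
    (r t t' b b' S : R) :
  0 < t -> t < t' -> 0 <= b -> 0 <= b' ->
  (forall s : R, t <= s <= t' -> f s <= b) ->
  majorant_with_cost psi f r t b S ->
  majorant_with_cost psi f r t' b' (S + psi (b' / (t' - t)) * (t' - t)).
Proof.
move=> t0 tt' b0 b'0 fb [h [L [[L0 hL h0 hf hb] [mh hS]]]].
have d0 : 0 < t' - t by rewrite subr_gt0.
(* The maximum covers the case where [h t] already exceeds [b']: the piece is then constant. *)
pose A := Num.max 0 ((b' - h t) / (t' - t)).
have A0 : 0 <= A by rewrite le_max lexx.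
have Ab : A <= b' / (t' - t).
  rewrite ge_max divr_ge0 ?(ltW d0)//= ler_pM2r ?invr_gt0//.
  by rewrite gerBl (le_trans b0).
have bA : b' <= h t + A * (t' - t).
  rewrite addrC -lerBlDr -ler_pdivrMr// le_max lexx orbT//.
pose g s := if s <= t then h s else h t + A * (s - t).
have gl s : s < t -> (g^`()%classic) s = (h^`()%classic) s.
  move=> st; apply: near_eq_derive1; near=> u; rewrite /g ifT// ltW//.
  by near: u; exact: lt_nbhsl.
have gr s : t < s -> (g^`()%classic) s = A.
  move=> st; rewrite -[RHS]/(cst A s) -(derive1_affine (h t) A t).
  apply: near_eq_derive1; near=> u; rewrite /g leNgt ifF//.
  by apply/negbTE; rewrite negbK; near: u; exact: lt_nbhsr.
have gt : g t = h t by rewrite /g lexx.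
have gge s : t <= s -> g s = h t + A * (s - t).
  rewrite le_eqVlt => /predU1P[<-|ts]; first by rewrite gt subrr mulr0 addr0.
  by rewrite /g leNgt ts.
have mgl : measurable_fun (`]0, t[ : set R) (fun s => psi ((g^`()%classic) s)).
  apply: eq_measurable_fun mh => s; rewrite inE/= in_itv/= => /andP[_ st].
  by rewrite gl.
have mgr : measurable_fun (`[t, t'[ : set R) (fun s => psi ((g^`()%classic) s)).
  (* Nothing is known about the derivative at the knot [t], so this point is removed. *)
  apply/measurable_fun_itv_obnd_cbndP.
  apply: (@eq_measurable_fun _ _ _ _ _ (cst (psi A))) => // s.
  by rewrite inE/= in_itv/= => /andP[st _]; rewrite gr.
have itvE : `]0, t'[%classic = `]0, t[%classic `|` `[t, t'[%classic.
  by apply: itv_bndbnd_setU; rewrite bnd_simp// ltW.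
exists g, (L + A); split; [split => //|split].
- by rewrite addr_ge0.
- move=> x y xy; have [yt|ty] := leP y t.
    have xt := le_trans xy yt; rewrite /g yt xt (le_trans (hL _ _ xy))//.
    by rewrite ler_wpM2r ?subr_ge0// lerDl.
  rewrite (gge y (ltW ty)); have [xt|tx] := leP x t.
    rewrite /g xt.
    have -> : h t + A * (y - t) - h x = (h t - h x) + A * (y - t) by ring.
    apply: le_trans (ler_normD _ _) _.
    have AA : 0 <= A * (y - t) by rewrite mulr_ge0// subr_ge0 ltW.
    rewrite (ger0_norm AA) mulrDl; apply: lerD.
      apply: le_trans (hL _ _ xt) _; apply: ler_wpM2l => //.
      by rewrite lerB// ltW.
    by apply: ler_wpM2l => //; rewrite lerB.
  rewrite (gge x (ltW tx)).
  have -> : h t + A * (y - t) - (h t + A * (x - t)) = A * (y - x) by ring.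
  rewrite ger0_norm ?mulr_ge0 ?subr_ge0//.
  by rewrite ler_wpM2r ?subr_ge0// lerDr.
- by rewrite /g (ltW t0).
- move=> s /andP[s0 st']; have [st|ts] := leP s t.
    by rewrite /g st hf// s0.
  rewrite (gge s (ltW ts)); apply: (@le_trans _ _ b); first by rewrite fb// st' ltW.
  by rewrite (le_trans hb)// lerDl mulr_ge0// subr_ge0 ltW.
- by rewrite (gge t' (ltW tt')).
- by rewrite itvE; apply/measurable_funU.
- rewrite itvE ge0_integral_setU//=; last 3 first.
  + by apply/measurable_EFinP; apply/measurable_funU.
  + by move=> x _; rewrite lee_fin.
  + rewrite disj_set2E; apply/eqP; rewrite -subset0 => a /=.
    by rewrite !in_itv/= => -[/andP[_ a1] /andP[a2 _]]; move: a1; rewrite ltNge a2.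
  rewrite EFinD; apply: leeD.
    apply: le_trans hS; rewrite le_eqVlt; apply/orP; left; apply/eqP.
    by apply: eq_integral => s; rewrite inE/= in_itv/= => /andP[_ st]; rewrite gl.
  rewrite -integral_itv_obnd_cbnd; last first.
    by apply/measurable_EFinP; apply/measurable_fun_itv_obnd_cbndP.
  rewrite (eq_integral (cst (psi A)%:E)); last first.
    by move=> s; rewrite inE/= in_itv/= => /andP[st _]; rewrite gr.
  rewrite integral_cst//= lebesgue_measure_itv/= lte_fin tt' -EFinB -EFinM lee_fin.
  by rewrite ler_wpM2r ?psi_nd// ltW.
Unshelve. all: by end_near. Qed.

(** * Base-4 chaining and the bounded action for a fixed path *)

Lemma natr_le_expn (R : realType) (n : nat) : (n%:R : R) <= 4 ^+ n.
Proof. by rewrite -natrX ler_nat ltnW// ltn_expl. Qed.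

(** Values at grid points of level [n] are sums of increments of levels at most [n]; their geometric
    decay gives a bound uniform in [n], and continuity carries it from the grids to every [t]. *)
Lemma chaining_bound (R : realType) (f : R -> R) (T D : R) :
  {within `[0, +oo[, continuous f} -> f 0 = 0 -> 0 < T -> 0 <= D ->
  (forall n i, (i < 4 ^ n)%N ->
    `|f (T * i.+1%:R / 4 ^+ n) - f (T * i%:R / 4 ^+ n)| <= D * (3 / 4) ^+ n) ->
  forall t, 0 <= t <= T -> `|f t| <= 12 * D.
Proof.
move=> fc f0 T0 D0 fD.
have grid n i : (i <= 4 ^ n)%N ->
    `|f (T * i%:R / 4 ^+ n)| <= 12 * D * (1 - (3 / 4) ^+ n.+1).
  (* The factor is [3 * \sum_(m <= n) (3 / 4) ^+ m = 12 * (1 - (3 / 4) ^+ n.+1)]: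
     a point of level [n] is at most [3] steps away from one of level [n.-1]. *)
  elim: n i => [|n IH] i; rewrite ?expn0 => i4.
    rewrite expr1; case: i i4 => [|[|//]] _.
      by rewrite mulr0 mul0r f0 normr0; nra.
    have := fD 0 0 isT; rewrite mulr0 mul0r f0 subr0 expr0 mulr1.
    by move=> /le_trans; apply; lra.
  (* Point [i] of level [n.+1] is reached from point [i %/ 4] of level [n] in [i %% 4] fine steps;
     [b] counts the steps made. *)
  have sub b : (4 * (i %/ 4) + b <= 4 ^ n.+1)%N ->
    `|f (T * (4 * (i %/ 4) + b)%:R / 4 ^+ n.+1)|
      <= 12 * D * (1 - (3 / 4) ^+ n.+1) + b%:R * (D * (3 / 4) ^+ n.+1).
    elim: b => [|b IHb] hb.
      rewrite addn0 mul0r addr0.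
      have -> : T * (4 * (i %/ 4))%:R / 4 ^+ n.+1 = T * (i %/ 4)%:R / 4 ^+ n.
        rewrite natrM exprS mulrCA -mulf_div divff ?mul1r//.
      apply: IH; move: hb; rewrite addn0 expnS leq_pmul2l//.
    have hb' : (4 * (i %/ 4) + b < 4 ^ n.+1)%N by rewrite -addnS.
    have := fD n.+1 _ hb'; have := IHb (ltnW hb'); rewrite addnS.
    set u := f _; set v := f _ => hu hv.
    have -> : v = u + (v - u) by ring.
    apply: le_trans (ler_normD _ _) _.
    apply: le_trans (lerD hu hv) _.
    rewrite -[b.+1]addn1 natrD; lra.
  have := sub (i %% 4)%N; rewrite mulnC -divn_eq => /(_ i4) /le_trans; apply.
  have b3 : ((i %% 4)%N%:R : R) <= 3 by rewrite ler_nat -ltnS ltn_mod.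
  have q0 : (0 : R) <= D * (3 / 4) ^+ n.+1 by rewrite mulr_ge0// exprn_ge0.
  apply: (@le_trans _ _ (12 * D * (1 - (3 / 4) ^+ n.+1) + 3 * (D * (3 / 4) ^+ n.+1))).
    by rewrite lerD2l ler_wpM2r.
  by rewrite [in leRHS]exprS; lra.
have grid12 n i : (i <= 4 ^ n)%N -> `|f (T * i%:R / 4 ^+ n)| <= 12 * D.
  move=> /grid/le_trans; apply; apply: ler_piMr; first exact: mulr_ge0.
  by rewrite lerBlDr lerDl exprn_ge0.
move=> t /andP[]; rewrite le_eqVlt => /predU1P[<- _|t0 tT].
  by rewrite f0 normr0 mulr_ge0.
apply/ler_addgt0Pr => e e0.
have /continuous_within_itvcyP[/in_continuous_mksetP cf _] := fc.
have /cvgrPdist_lt/(_ e e0) : {for t, continuous f}.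
  by apply: cf; rewrite inE/= in_itv/= t0.
move=> /nbhs_ballP[dl /= dl0 hdl].
(* A level so fine that the last grid point [s <= t] lies within [dl] of [t]. *)
pose n := (Num.truncn (T / dl)).+1.
have Tn : T / 4 ^+ n < dl.
  rewrite ltr_pdivrMr ?exprn_gt0// mulrC -ltr_pdivrMr//.
  apply: lt_le_trans (natr_le_expn R n).
  by have /andP[] := truncn_itv (divr_ge0 (ltW T0) (ltW dl0)).
pose i := Num.truncn (t * 4 ^+ n / T).
have /andP[i1 i2] : (i%:R : R) <= t * 4 ^+ n / T < i.+1%:R.
  by apply: truncn_itv; rewrite divr_ge0 ?mulr_ge0 ?exprn_ge0// ltW.
have p4 : (0 : R) < 4 ^+ n by rewrite exprn_gt0.
set s := T * i%:R / 4 ^+ n.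
have st : s <= t.
  by rewrite /s ler_pdivrMr// mulrC -ler_pdivlMr.
have ts : t - s < dl.
  apply: le_lt_trans Tn; rewrite lerBlDl.
  have -> : s + T / 4 ^+ n = T * i.+1%:R / 4 ^+ n.
    by rewrite /s -[i.+1]addn1 natrD mulrDr mulr1 mulrDl.
  by rewrite ler_pdivlMr// [leRHS]mulrC -ler_pdivrMr// ltW.
have i4 : (i <= 4 ^ n)%N.
  rewrite -(ler_nat R) (le_trans i1)// natrX ler_pdivrMr// mulrC.
  by rewrite ler_wpM2l// ltW.
have fst : `|f t - f s| < e.
  by apply: hdl; rewrite /ball/= ger0_norm// subr_ge0.
have -> : f t = f s + (f t - f s) by ring.
apply: le_trans (ler_normD _ _) _.
by apply: lerD; [exact: grid12|exact: ltW].
Qed.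

(* The shift by [8] absorbs the constants, making the slope between the knots
   [4 ^+ (n + 6)] and [4 ^+ (n + 7)] at most [2 ^- (n - J n)]. *)
Lemma min_action_bounded (R : realType) (psi f : R -> R)
    (psi_ge0 : forall x, 0 <= psi x)
    (psi_nd : forall x y : R, 0 <= x -> x <= y -> psi x <= psi y)
    (r : R) (N : nat) (J : nat -> nat) (S : R) :
  0 < r -> {within `[0, +oo[, continuous f} -> f 0 = 0 ->
  (forall n, (N <= n)%N -> (J n <= n)%N /\
    forall t : R, 0 <= t <= 4 ^+ (n + 8) -> f t <= 2 ^+ (n + J n + 12)) ->
  (forall n, \sum_(i < n) 4 ^+ (N + i.+1) *
      psi (2 ^- (N + i.+1 - J (N + i.+1)%N)) <= S) ->
  exists M : R, forall T, 0 < T -> (min_action psi f T r <= M%:E)%E.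
Proof.
move=> r0 fc f0 hJ hS.
have /continuous_within_itvcyP[_ fr] := fc.
have [dl dl0 hdl] : exists2 dl : R, 0 < dl & forall s : R, 0 <= s <= dl -> f s <= r.
  have /nbhs_right0P[e /= e0 he] : \forall s \near 0^'+, f s < r.
    by apply: (cvgr_lt (f 0) fr); rewrite f0.
  exists (e / 2); first by rewrite divr_gt0.
  move=> s /andP[]; rewrite le_eqVlt => /predU1P[<- _|s0 se]; first by rewrite f0 ltW.
  rewrite ltW// -[s]add0r; apply: he => //=.
  by rewrite sub0r normrN gtr0_norm// (le_lt_trans se)// ltr_pdivrMr// ltr_pMr// ltr1n.
have b0 n : (0 : R) <= 2 ^+ n by rewrite exprn_ge0.
have t0 n : (0 : R) < 4 ^+ n by rewrite exprn_gt0.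
have [S0 base] : exists S0, majorant_with_cost psi f r (4 ^+ (N + 7)) (2 ^+ (N + J N + 12)) S0.
  apply: (@affine_majorant _ _ _ psi_ge0 _ _ _ (2 ^+ (N + J N + 12)) _
    (t0 _) dl0 hdl _ (ltW r0)).
  move=> s /andP[s0 sN]; apply: (hJ N (leqnn N)).2; rewrite s0 (le_trans sN)//.
  by rewrite ler_weXn2l ?ler1n// leq_add2l.
(* At the knot [4 ^+ (N + n + 7)] the majorant has reached the bound of [f] valid up to the next
   knot [4 ^+ (N + n + 8)], as [extend_majorant] requires. *)
have step n : majorant_with_cost psi f r (4 ^+ (N + n + 7))
    (2 ^+ (N + n + J (N + n)%N + 12))
    (S0 + 3 * 4 ^+ 6 * \sum_(i < n) 4 ^+ (N + i.+1) *
      psi (2 ^- (N + i.+1 - J (N + i.+1)%N))).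
  elim: n => [|n IH]; first by rewrite !addn0 big_ord0 mulr0 addr0.
  have lt4 : (4 : R) ^+ (N + n + 7) < 4 ^+ (N + n.+1 + 7).
    by rewrite ltr_eXn2l ?ltr1n//; lia.
  have fb s : 4 ^+ (N + n + 7) <= s <= 4 ^+ (N + n.+1 + 7) ->
      f s <= 2 ^+ (N + n + J (N + n)%N + 12).
    move=> /andP[s0 sn]; apply: (hJ (N + n)%N (leq_addr _ _)).2.
    rewrite (le_trans (ltW (t0 _)) s0) (le_trans sn)//.
    by rewrite ler_weXn2l ?ler1n//; lia.
  have := extend_majorant psi_ge0 psi_nd (t0 _) lt4 (b0 _)
    (b0 (N + n.+1 + J (N + n.+1)%N + 12)%N) fb IH.
  have {}JN := (hJ (N + n.+1)%N (leq_addr _ _)).1.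
  move=> [h [L [hL [mh hC]]]]; exists h, L; split => //; split => //.
  apply: le_trans hC _; rewrite lee_fin big_ord_recr/= [X in _ <= _ + X]mulrDr [leRHS]addrA lerD2l.
  set m := (N + n.+1)%N in JN *.
  (* Consecutive knots are [3 * 4 ^+ (m + 6)] apart, the source of the constant [3 * 4 ^+ 6]. *)
  have d : (4 : R) ^+ (m + 7) - 4 ^+ (N + n + 7) = 3 * 4 ^+ (N + n + 7).
    have -> : (m + 7 = (N + n + 7).+1)%N by rewrite /m; lia.
    by rewrite exprS; ring.
  rewrite d.
  have -> : 3 * 4 ^+ 6 * (4 ^+ m * psi (2 ^- (m - J m))) =
      psi (2 ^- (m - J m)) * (3 * 4 ^+ (N + n + 7)) :> R.
    have -> : (N + n + 7 = 6 + m)%N by rewrite /m; lia.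
    by rewrite exprD; move: (4 ^+ 6) => c; ring.
  rewrite ler_wpM2r ?mulr_ge0//; apply: psi_nd.
    by rewrite divr_ge0// mulr_ge0.
  (* Since [4 ^+ (m + 6) = 2 ^+ (2 * m + 12)], the powers of [2] cancel exactly and the factor [3]
     is spare. *)
  rewrite ler_pdivrMr ?mulr_gt0// mulrC ler_pdivlMr ?exprn_gt0//.
  rewrite -exprD.
  have -> : (m + J m + 12 + (m - J m) = 2 * (N + n + 7))%N by rewrite /m in JN *; lia.
  rewrite exprM (_ : 2 ^+ 2 = 4); last by rewrite -natrX.
  by apply: ler_peMl => //; rewrite ler1n.
exists (S0 + 3 * 4 ^+ 6 * S) => T T0.
have [n Tn] : exists n, T <= 4 ^+ (N + n + 7).
  exists (Num.truncn T).+1; apply: (@le_trans _ _ (4 ^+ (Num.truncn T).+1)).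
    apply: le_trans (natr_le_expn R _); rewrite ltW//.
    by have /andP[] := truncn_itv (ltW T0).
  by rewrite ler_weXn2l ?ler1n// addnAC leq_addl.
apply: le_trans (le_min_action psi_ge0 f r Tn) _.
apply: le_trans (min_action_le_cost (step n)) _.
by rewrite lee_fin lerD2l ler_wpM2l.
Qed.

(** * Fourth-power Gaussian tails *)

(* Exponential tilting: the centered density is compared with the one of mean [m],
   whose total mass is [1], so that no Gaussian integral is needed. *)
Lemma normal_prob_halfline (R : realType) (m s : R) (B : set R) :
  0 < s -> measurable B -> (forall x, B x -> m ^+ 2 <= m * x) ->
  (normal_prob 0 s B <= (expR (- (m ^+ 2 / (2 * s ^+ 2))))%:E)%E.
Proof.
move=> s0 mB mx; set c := expR _.
have sn0 : s != 0 by rewrite gt_eqF.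
apply: (@le_trans _ _ (\int[lebesgue_measure]_(x in B) (c%:E * (normal_pdf m s x)%:E))%E).
  apply: le_integral_ge0 => x Bx; first by rewrite lee_fin normal_pdf_ge0.
  rewrite -EFinM lee_fin !normal_pdfE// /normal_fun mulrCA ler_wpM2l ?normal_peak_ge0//.
  rewrite -expRD ler_expR.
  have -> : - (m ^+ 2 / (2 * s ^+ 2)) + - (x - m) ^+ 2 / (s ^+ 2 *+ 2)
    = - x ^+ 2 / (s ^+ 2 *+ 2) + (m * x - m ^+ 2) / s ^+ 2 by field.
  by rewrite subr0 lerDl divr_ge0 ?sqr_ge0// subr_ge0; exact: mx.
rewrite ge0_integralZl//.
- have : (normal_prob m s B <= 1)%E by exact: probability_le1.
  move=> /(lee_wpmul2l _) => /(_ c%:E); rewrite mule1; apply.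
  by rewrite lee_fin expR_ge0.
- apply/measurable_EFinP; apply: measurable_funTS.
  exact: measurable_normal_pdf.
- by move=> x _; rewrite lee_fin normal_pdf_ge0.
- by rewrite lee_fin expR_ge0.
Qed.

(** Squaring [exp (u / 2) >= 1 + u / 2 >= u / 2] bounds [exp u] from below by [u^2 / 4]. *)
Lemma expRN_le (R : realType) (u : R) : 0 < u -> expR (- u) <= 4 / u ^+ 2.
Proof.
move=> u0; rewrite expRN -[4 / _]invrK lef_pV2 ?posrE ?expR_gt0 ?invr_gt0 ?divr_gt0 ?exprn_gt0//.
have -> : u = u / 2 + u / 2 by field.
rewrite expRD -expr2.
have -> : (4 / (u / 2 + u / 2) ^+ 2)^-1 = (u / 2) ^+ 2 by field; rewrite gt_eqF//; apply: addr_gt0.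
have := expR_ge1Dx (u / 2) => h; rewrite ler_pXn2r ?nnegrE ?expR_ge0 ?divr_ge0 ?(ltW u0)//.
by apply: le_trans h; rewrite lerDr.
Qed.

(** The tilts [m = y] and [m = - y] treat the two half-lines; with [u = y^2 / (2 * s^2)], [expRN_le]
    gives [16 * (s / y)^4] for each. *)
Lemma normal_prob_tail (R : realType) (s y : R) : 0 < s -> 0 < y ->
  (normal_prob 0 s [set x | (y < `|x|)%R] <= (32 * (s / y) ^+ 4)%:E)%E.
Proof.
move=> s0 y0.
have bnd (B : set R) m : measurable B -> m ^+ 2 = y ^+ 2 ->
    (forall x, B x -> m ^+ 2 <= m * x) ->
    (normal_prob 0 s B <= (16 * (s / y) ^+ 4)%:E)%E.
  move=> mB my mx; apply: le_trans (normal_prob_halfline s0 mB mx) _.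
  rewrite lee_fin my; apply: le_trans (expRN_le _) _.
    by rewrite divr_gt0 ?mulr_gt0 ?exprn_gt0.
  rewrite le_eqVlt; apply/orP; left; apply/eqP; field.
  by rewrite !gt_eqF.
have -> : [set x : R | y < `|x|] = `]y, +oo[%classic `|` `]-oo, - y[%classic.
  by apply/seteqP; split => x /=; rewrite !in_itv/= andbT ltr_normr ltrNr => /orP.
have -> : 32 * (s / y) ^+ 4 = 16 * (s / y) ^+ 4 + 16 * (s / y) ^+ 4 by ring.
apply: le_trans (measureU2 _ _ _) _ => //; rewrite EFinD.
apply: leeD.
  apply: (bnd _ y) => // x; rewrite /= in_itv/= andbT => yx.
  by rewrite expr2 ler_pM2l// ltW.
apply: (bnd _ (- y)) => //; first by rewrite sqrrN.
move=> x; rewrite /= in_itv/= => xy.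
by rewrite expr2 ler_nM2l ?oppr_lt0// ltW.
Qed.

Lemma wiener_increment_tail d (Omega : measurableType d) (R : realType)
    (P : probability Omega R) (W : R -> {RV P >-> R}) (a b s y : R) :
  wiener_process P W -> 0 <= a -> 0 < s -> b - a = s ^+ 2 -> 0 < y ->
  (P [set w | (y < `|W b w - W a w|)%R] <= (32 * (s / y) ^+ 4)%:E)%E.
Proof.
move=> hW a0 s0 ba y0.
have ab : a < b by rewrite -subr_gt0 ba exprn_gt0.
have mB : measurable [set x : R | y < `|x|].
  rewrite (_ : [set x | _] = (@Num.norm R R) @^-1` `]y, +oo[%classic); last first.
    by apply/seteqP; split => x /=; rewrite in_itv/= andbT.
  rewrite -[X in measurable X]setTI.
  by exact: (@normr_measurable R setT).
have := wiener_gaussian_increments hW a0 ab mB.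
rewrite ba sqrtr_sqr gtr0_norm// /pushforward => PE.
by have := normal_prob_tail s0 y0; rewrite -PE.
Qed.

(** * Chaining events and their probability *)

Lemma nneseries_le (R : realType) (u : nat -> \bar R) (M : \bar R) :
  (forall n, 0 <= u n)%E -> (forall n, \sum_(i < n) u i <= M)%E ->
  (\sum_(n <oo) u n <= M)%E.
Proof.
move=> u0 uM; apply: lime_le; first exact: is_cvg_nneseries.
by apply: nearW => n; rewrite big_mkord.
Qed.

Lemma geometric_sum_le (R : realType) (q : R) (n : nat) :
  0 <= q -> q < 1 -> \sum_(i < n) q ^+ i <= (1 - q)^-1.
Proof.
move=> q0 q1; have d0 : 0 < 1 - q by rewrite subr_gt0.
rewrite -[leRHS]mul1r ler_pdivlMr// mulrC -opprB mulNr -subrX1 opprB.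
by rewrite gerBl exprn_ge0.
Qed.

Definition large_increment d (Omega : measurableType d) (R : realType)
    (P : probability Omega R) (W : R -> {RV P >-> R}) (T D : R) (n i : nat) :
    set Omega :=
  [set w | D * (3 / 4) ^+ n <
           `|W (T * i.+1%:R / 4 ^+ n) w - W (T * i%:R / 4 ^+ n) w|].

(* The factor [3 / 4] balances summability of the thresholds over [n] against
   [4 ^ n] increments, each of probability [O((2 / 3) ^ (4 * n))]. *)
Definition irregular d (Omega : measurableType d) (R : realType)
    (P : probability Omega R) (W : R -> {RV P >-> R}) (T D : R) : set Omega :=
  \bigcup_n \big[setU/set0]_(i < 4 ^ n) large_increment W T D n i.

Lemma measurable_large_increment d (Omega : measurableType d) (R : realType)
    (P : probability Omega R) (W : R -> {RV P >-> R}) (T D : R) (n i : nat) :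
  measurable (large_increment W T D n i).
Proof.
rewrite /large_increment.
set f := fun w => _.
rewrite (_ : f = (Num.norm \o (W (T * i.+1%:R / 4 ^+ n) \- W (T * i%:R / 4 ^+ n)))
  @^-1` `]D * (3 / 4) ^+ n, +oo[%classic); last first.
  by apply/seteqP; split => x /=; rewrite in_itv/= andbT.
rewrite -[X in measurable X]setTI.
apply: (@measurableT_comp _ _ _ _ _ _ (@Num.norm R R)) => //.
Qed.

Lemma measurable_irregular d (Omega : measurableType d) (R : realType)
    (P : probability Omega R) (W : R -> {RV P >-> R}) (T D : R) :
  measurable (irregular W T D).
Proof.
apply: bigcupT_measurable => n; apply: bigsetU_measurable => i _.
exact: measurable_large_increment.
Qed.

(** An increment of level [n] has standard deviation [2^k / 2^n], which is [2^-j * (2/3)^n] times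
    its threshold. The fourth power of this ratio, times [4^n] increments, leaves a geometric series
    of ratio [64/81], and [32 * 81/17] is below [160]. *)
Lemma irregular_prob d (Omega : measurableType d) (R : realType)
    (P : probability Omega R) (W : R -> {RV P >-> R}) (k j : nat) :
  wiener_process P W ->
  (P (irregular W (4 ^+ k) (2 ^+ (k + j))) <= (160 * 16 ^- j)%:E)%E.
Proof.
move=> hW.
have x0 (x : R) n : 0 < x -> 0 < x ^+ n by move=> ?; rewrite exprn_gt0.
have EP n i : (P (large_increment W (4 ^+ k) (2 ^+ (k + j)) n i) <=
    (32 * 16 ^- j * (16 / 81) ^+ n)%:E)%E.
  have := @wiener_increment_tail _ _ _ _ W (4 ^+ k * i%:R / 4 ^+ n)
     (4 ^+ k * i.+1%:R / 4 ^+ n) (2 ^+ k / 2 ^+ n) (2 ^+ (k + j) * (3 / 4) ^+ n) hW.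
  have -> : 2 ^+ k / 2 ^+ n / (2 ^+ (k + j) * (3 / 4) ^+ n) = 2 ^- j * (2 / 3) ^+ n :> R.
    have -> : (2 / 3 : R) = (2 * (3 / 4))^-1 by field.
    rewrite exprVn [(2 * _) ^+ n]exprMn exprD; field.
    by rewrite !gt_eqF ?x0// divr_gt0.
  have -> : (2 ^- j * (2 / 3) ^+ n) ^+ 4 = 16 ^- j * (16 / 81) ^+ n :> R.
    have -> : (16 / 81 : R) = (2 / 3) ^+ 4 by field.
    have -> : (16 : R) = 2 ^+ 4 by ring.
    by rewrite exprMn exprVn -!exprM [(j * 4)%N]mulnC [(n * 4)%N]mulnC.
  rewrite mulrA; apply.
  - by rewrite divr_ge0 ?mulr_ge0// ltW// x0.
  - by rewrite divr_gt0 ?x0.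
  - rewrite -[i.+1]addn1 natrD mulrDr mulr1 mulrDl addrAC subrr add0r.
    rewrite expr_div_n -!exprM ![(_ * 2)%N]mulnC !exprM.
    by have -> : (2 : R) ^+ 2 = 4 by ring.
  - by rewrite mulr_gt0 ?x0// divr_gt0.
apply: le_trans (generalized_Boole_inequality _ _ _) _.
- by move=> n; apply: bigsetU_measurable => i _; exact: measurable_large_increment.
- exact: measurable_irregular.
apply: nneseries_le => [n|N]; first exact: measure_ge0.
apply: (@le_trans _ _ (\sum_(n < N) (32 * 16 ^- j * (64 / 81) ^+ n)%:E)%E).
  apply: lee_sum => n _; apply: le_trans (Boole_inequality _ _) _.
    by move=> i _; exact: measurable_large_increment.
  apply: (@le_trans _ _ (\sum_(i < 4 ^ n) (32 * 16 ^- j * (16 / 81) ^+ n)%:E)%E).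
    by apply: lee_sum => i _; exact: EP.
  rewrite sumEFin lee_fin sumr_const card_ord -[leLHS]mulr_natl natrX.
  have -> : (64 / 81 : R) = 4 * (16 / 81) by field.
  by rewrite [(4 * _) ^+ n]exprMn mulrCA.
rewrite sumEFin lee_fin -mulr_sumr.
apply: le_trans (ler_wpM2l _ (geometric_sum_le _ _ _)) _.
- by rewrite mulr_ge0// invr_ge0 ltW// x0.
- by [].
- lra.
- have -> : (1 - 64 / 81)^-1 = 81 / 17 :> R by field.
  by rewrite mulrAC ler_wpM2r ?invr_ge0 ?(ltW (x0 _ _ _))//; lra.
Qed.

Lemma regular_path_bound d (Omega : measurableType d) (R : realType)
    (P : probability Omega R) (W : R -> {RV P >-> R}) (w : Omega) (k j : nat) :
  {within `[0, +oo[, continuous (fun t : R => W t w)} -> W 0 w = 0 ->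
  ~ irregular W (4 ^+ k) (2 ^+ (k + j)) w ->
  forall t : R, 0 <= t <= 4 ^+ k -> W t w <= 2 ^+ (k + j + 4).
Proof.
move=> Wc W0 reg t tk.
have D0 : (0 : R) <= 2 ^+ (k + j) by rewrite exprn_ge0.
apply: le_trans (ler_norm _) _; apply: (@le_trans _ _ (12 * 2 ^+ (k + j))).
  apply: (@chaining_bound R (fun t => W t w) (4 ^+ k)) => //.
  move=> n i i4; rewrite leNgt; apply/negP => Wn; apply: reg.
  exists n => //; rewrite -(bigcup_mkord (4 ^ n) (large_increment W (4 ^+ k) (2 ^+ (k + j)) n)).
  by exists i.
rewrite [leRHS]exprD [leLHS]mulrC ler_wpM2l//.
have -> : (2 : R) ^+ 4 = 16 by ring.
by rewrite ler_nat.
Qed.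

(** * Cauchy products, almost sure finiteness and least regular levels *)

(** The triangle [j <= l < n] is summed by columns, with [m = l - j]; each column is at most
    [g j * A]. *)
Lemma antidiagonal_sum_le (R : realType) (a g : nat -> R) (A G : R) (n : nat) :
  (forall i, 0 <= a i) -> (forall i, 0 <= g i) ->
  (forall n, \sum_(i < n) a i <= A) -> (forall n, \sum_(i < n) g i <= G) ->
  \sum_(l < n) \sum_(j < l.+1) g j * a (l - j)%N <= G * A.
Proof.
move=> a0 g0 aA gG.
have -> : \sum_(l < n) \sum_(j < l.+1) g j * a (l - j)%N =
    \sum_(j < n) \sum_(m < n - j) g j * a m.
  elim: n => [|n IH]; first by rewrite !big_ord0.
  rewrite big_ord_recr/= IH.
  (* The empty column [j = n] is added, after which every column grows by exactly one term. *)
  have -> : \sum_(j < n) \sum_(m < n - j) g j * a m =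
      \sum_(j < n.+1) \sum_(m < n - j) g j * a m.
    by rewrite [RHS]big_ord_recr/= subnn big_ord0 addr0.
  rewrite -big_split/=; apply: eq_bigr => j _.
  by rewrite subSn ?big_ord_recr// -ltnS.
apply: (@le_trans _ _ (\sum_(j < n) g j * A)).
  by apply: ler_sum => j _; rewrite -mulr_sumr ler_wpM2l.
rewrite -mulr_suml ler_wpM2r//.
by have := aA 0; rewrite big_ord0.
Qed.

(** Exchanging sum and integral shows the sum to be integrable, hence finite almost everywhere. *)
Lemma ae_nneseries_lty d (T : measurableType d) (R : realType)
    (mu : {measure set T -> \bar R}) (f : nat -> T -> \bar R) (C : R) :
  (forall n, measurable_fun setT (f n)) -> (forall n x, 0 <= f n x)%E ->
  (forall n, \sum_(i < n) \int[mu]_x f i x <= C%:E)%E ->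
  {ae mu, forall x, (\sum_(n <oo) f n x < +oo)%E}.
Proof.
move=> mf f0 fC.
have F0 x : (0 <= \sum_(n <oo) f n x)%E by apply: nneseries_ge0.
have : mu.-integrable setT (fun x => \sum_(n <oo) f n x)%E.
  apply/integrableP; split; first exact: ge0_emeasurable_sum.
  rewrite (eq_integral (fun x => \sum_(n <oo) f n x)%E); last first.
    by move=> x _; rewrite gee0_abs.
  rewrite integral_nneseries//; apply: (@le_lt_trans _ _ C%:E); last exact: ltry.
  by apply: nneseries_le => // n; exact: integral_ge0.
move=> /(integrable_ae measurableT); apply: filterS => x /(_ Logic.I).
by rewrite ge0_fin_numE.
Qed.

(** Borel-Cantelli in threshold form; the exceptional null set is [lim_sup_set A]. *)
Lemma ae_eventually_not d (T : measurableType d) (R : realType)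
    (mu : {measure set T -> \bar R}) (A : nat -> set T) :
  (forall n, measurable (A n)) -> (\sum_(n <oo) mu (A n) < +oo)%E ->
  {ae mu, forall x, exists N, forall n, (N <= n)%N -> ~ A n x}.
Proof.
move=> mA sA; exists (lim_sup_set A); split.
- by apply: bigcapT_measurable => n; apply: bigcup_measurable => k _.
- exact: lim_sup_set_cvg0.
- move=> x /= xA n _; apply: contrapT => h; apply: xA; exists n => k nk Ak.
  by apply: h; exists k.
Qed.

(** [B] is [A] shifted by one level, so minimality of [J n] places [x] in [B n (J n)]. The
    path-dependent index can thus be estimated through the sets [B] alone. *)
Lemma least_regular_level d (T : measurableType d) (A B : nat -> nat -> set T)
    (x : T) (N : nat) :
  (forall n, B n 0%N = setT) -> (forall n j, B n j.+1 = A n j) ->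
  (forall n, (N <= n)%N -> ~ A n n x) ->
  exists J : nat -> nat, forall n, (N <= n)%N ->
    [/\ (J n <= n)%N, ~ A n (J n) x & B n (J n) x].
Proof.
move=> B0 BS hA.
have H n : exists j, (N <= n)%N -> [/\ (j <= n)%N, ~ A n j x & B n j x].
  have [Nn|_] := leqP N n; last by exists 0%N.
  have ex : exists j, `[< ~ A n j x >] by exists n; exact/asboolP/hA.
  case: (ex_minnP ex) => j /asboolP Aj jmin.
  exists j => _; split => //; first by apply: jmin; exact/asboolP/hA.
  case: j Aj jmin => [|j] Aj jmin; first by rewrite B0.
  rewrite BS; apply: contrapT => /asboolP /jmin; by rewrite ltnn.
by have [J hJ] := choice H; exists J.
Qed.

(** * Expected cost and the almost sure bound *)

Lemma wiener_min_action_bounded d (Omega : measurableType d) (R : realType)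
    (P : probability Omega R) (W : R -> {RV P >-> R}) (r : R) (psi : R -> R)
    (M : R) :
  wiener_process P W -> 0 < r -> (forall x, 0 <= psi x) ->
  (forall x y : R, 0 <= x -> x <= y -> psi x <= psi y) ->
  (forall n, \sum_(m < n) 4 ^+ m * psi (2 ^- m) <= M) ->
  \forall w \ae P, exists C : R, forall T, 0 < T ->
    (min_action psi (fun t => W t w) T r <= C%:E)%E.
Proof.
move=> hW r0 psi_ge0 psi_nd psiM.
pose A l j := irregular W (4 ^+ (l + 8)) (2 ^+ (l + 8 + j)).
pose B l j := if j is j'.+1 then A l j' else setT.
have mA l j : measurable (A l j) by exact: measurable_irregular.
have mB l j : measurable (B l j) by case: j => [|j] /=.
have PA l j : (P (A l j) <= (160 * 16 ^- j)%:E)%E by exact: irregular_prob.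
(* The shift from [A] to [B] costs the factor [16]. *)
have PB l j : (P (B l j) <= (160 * 16 * 16 ^- j)%:E)%E.
  case: j => [|j]; first by rewrite /= probability_setT lee_fin expr0; lra.
  apply: le_trans (PA l j) _; rewrite lee_fin le_eqVlt; apply/orP; left; apply/eqP.
  by rewrite exprS; field; rewrite expf_neq0.
pose a m := 4 ^+ m * psi (2 ^- m).
have a0 m : 0 <= a m by rewrite mulr_ge0// exprn_ge0.
pose c l j := 4 ^+ j * a (l - j)%N.
have c0 l j : 0 <= c l j by rewrite mulr_ge0// exprn_ge0.
(* [c l j] is the cost [4^l * psi (2^-(l - j))] of scale [l] when the least level is [j]. Summing
   over all [j <= l] with indicators of [B l j] dominates the cost at the least level by a
   measurable function. *)
pose D l w := (\sum_(j < l.+1) (c l j)%:E * (\1_(B l j) w)%:E)%E.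
have mBi l j : measurable_fun setT (fun w => (\1_(B l j) w)%:E : \bar R).
  by apply/measurable_EFinP; exact: measurable_indic.
have D0 l w : (0 <= D l w)%E.
  by apply: sume_ge0 => j _; rewrite -EFinM lee_fin mulr_ge0.
have mD l : measurable_fun setT (D l).
  by apply: emeasurable_sum => j; apply: measurable_funeM.
have intD l : (\int[P]_w D l w <=
    (160 * 16 * \sum_(j < l.+1) 4 ^- j * a (l - j)%N)%:E)%E.
  rewrite ge0_integral_sum//; last 2 first.
  - by move=> j; apply: measurable_funeM.
  - by move=> j w _; rewrite -EFinM lee_fin mulr_ge0.
  rewrite mulr_sumr -sumEFin; apply: lee_sum => j _.
  rewrite ge0_integralZl//; last by rewrite lee_fin.
  rewrite integral_indic// setIT; apply: le_trans (lee_wpmul2l _ (PB l j)) _.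
    by rewrite lee_fin.
  (* The growth [4^j] of the cost against the probability [16^-j] leaves the summable weight
     [4^-j]. *)
  rewrite -EFinM lee_fin le_eqVlt; apply/orP; left; apply/eqP.
  have -> : (16 : R) ^- j = 4 ^- j * 4 ^- j.
    by rewrite -invfM -exprMn; congr (_ ^+ _)^-1; ring.
  have e4 : (4 : R) ^+ j != 0 by rewrite expf_neq0.
  by rewrite /c; field.
have aeD : \forall w \ae P, (\sum_(l <oo) D l w < +oo)%E.
  apply: (@ae_nneseries_lty _ _ _ _ _ (160 * 16 * ((1 - 4^-1)^-1 * M))) => // n.
  apply: (@le_trans _ _ (\sum_(l < n)
      (160 * 16 * \sum_(j < l.+1) 4 ^- j * a (l - j)%N)%:E)%E).
    by apply: lee_sum => l _; exact: intD.
  rewrite sumEFin lee_fin -mulr_sumr ler_wpM2l ?mulr_ge0//.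
  apply: (@antidiagonal_sum_le _ a (fun j => 4 ^- j)) => // m.
  under eq_bigr do rewrite -exprVn.
  by apply: geometric_sum_le; lra.
(* The diagonal events have probability [O(16^-n)]; once they fail, a regular level [j <= n]
   exists. *)
have aeA : \forall w \ae P, exists N, forall n, (N <= n)%N -> ~ A n n w.
  apply: (@ae_eventually_not _ _ _ _ (fun n => A n n)) => //.
  apply: (@le_lt_trans _ _ (160 * (1 - 16^-1)^-1)%:E); last exact: ltry.
  apply: nneseries_le => [n|n]; first exact: measure_ge0.
  apply: (@le_trans _ _ (\sum_(l < n) (160 * 16^-1 ^+ l)%:E)%E).
    by apply: lee_sum => l _; rewrite exprVn; exact: PA.
  rewrite sumEFin lee_fin -mulr_sumr ler_wpM2l//.
  by apply: geometric_sum_le; lra.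
have Ws := wiener_start hW.
have Wcs := wiener_continuous hW.
have aeAD : \forall w \ae P, (\sum_(l <oo) D l w < +oo)%E /\
    exists N, forall n, (N <= n)%N -> ~ A n n w.
  by move: aeD aeA; apply: filterS2.
move: Ws Wcs aeAD; apply: filterS3 => w W0 Wc []; set Z := (\sum_(l <oo) _)%E => Zoo [N hN].
have [J hJ] := @least_regular_level _ _ A B w N (fun=> erefl) (fun _ _ => erefl) hN.
have Z0 : (0 <= Z)%E by apply: nneseries_ge0.
have termD l : (N <= l)%N -> ((4 ^+ l * psi (2 ^- (l - J l)))%:E <= D l w)%E.
  (* Only the summand [j = J l] is kept; its indicator is [1] because the path lies in
     [B l (J l)]. *)
  move=> /hJ[Jl _ BJ]; have Jl' : (J l < l.+1)%N by [].
  rewrite /D (bigD1 (Ordinal Jl'))//= -[leLHS]adde0; apply: leeD; last first.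
    by apply: sume_ge0 => j _; rewrite -EFinM lee_fin mulr_ge0.
  rewrite indicE mem_set// mule1 lee_fin /c /a mulrA -exprD subnKC//.
apply: (@min_action_bounded _ _ _ psi_ge0 psi_nd r N J (fine Z)) => //.
  move=> l /hJ[Jl Al _]; split => // t t8.
  have -> : (l + J l + 12 = l + 8 + J l + 4)%N by lia.
  exact: regular_path_bound t8.
move=> n; rewrite -lee_fin fineK ?ge0_fin_numE// -sumEFin.
apply: (@le_trans _ _ (\sum_(i < n) D (N + i.+1)%N w)%E).
  by apply: lee_sum => i _; apply: termD; exact: leq_addr.
(* The terms in question are those of index [N.+1] to [N + n] of this partial sum; the earlier ones
   are nonnegative. *)
apply: (@le_trans _ _ (\sum_(0 <= l < N.+1 + n) D l w)%E); last first.
  exact: nneseries_lim_ge.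
rewrite (@big_cat_nat _ _ _ N.+1)//=; last exact: leq_addr.
rewrite -[leLHS]add0e; apply: leeD; first exact: sume_ge0.
rewrite -{1}[N.+1]add0n big_addn addKn big_mkord.
by apply: lee_sum => i _; rewrite addnC addSnnS.
Qed.

Theorem theorem9 (R : realType) (d : measure_display) (Omega : measurableType d)
    (P : probability Omega R) (W : R -> {RV P >-> R})
    (W_wiener : wiener_process P W)
    (r : R) (r_gt0 : 0 < r)
    (psi : R -> R) (psi_ge0 : forall x, 0 <= psi x)
    (psi_convex : convex_function [set: convex_lmodType R^o] psi)
    (psi0 : psi 0 = 0)
    (m_psi_lim : (lim (m_psi psi b @[b --> +oo%R]) < +oo)%E) :
  \forall w \ae P, let I_W T := min_action psi (fun t => W t w) T r in
    [/\ exists M : R, forall T, 0 < T -> (`|I_W T| <= M%:E)%E,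
        forall S T, 0 < S -> S <= T -> (I_W S <= I_W T)%E
      & exists l : R, I_W T @[T --> +oo%R] --> l%:E].
Proof.
have psi_nd := convex_ge0_nondecreasing psi_ge0 psi_convex psi0.
have [M psiM] := dyadic_sum_bounded psi_ge0 psi_nd m_psi_lim.
have := wiener_min_action_bounded W_wiener r_gt0 psi_ge0 psi_nd psiM.
apply: filterS => w [C WC]; split.
- by exists C => T /WC; rewrite gee0_abs// min_action_ge0.
- by move=> S T _; exact: le_min_action.
- exact: min_action_bounded_cvg WC.
Qed.
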